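(* For every integer $n\ge 1$, the number of labeled Riordan graphs of order $n$ (that is, the number of distinct simple graphs on the vertex set $[n]=\{1,\dots,n\}$ that are Riordan graphs) is $\dfrac{4^{n-1}+2}{3}$.
   Context: Write $a\equiv b$ for congruence modulo $2$ and $[t^k]h$ for the coefficient of $t^k$ in a formal power series $h$. For $g,f\in\mathbb{Z}[[t]]$ (or $\mathbb{Z}_2[[t]]$) with $f(0)=0$ and $n\ge 1$, the Riordan graph $G_n(g,f)$ is the simple graph with vertex set $[n]=\{1,\dots,n\}$ in which, for $i>j\ge 1$, the vertices $i$ and $j$ are adjacent if and only if $[t^{i-2}]\,g f^{\,j-1}\equiv 1$ (with $f^0=1$). A simple labeled graph on $[n]$ is a Riordan graph of order $n$ if it equals $G_n(g,f)$ for some such pair $(g,f)$. *)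

(* Defs.v *)
From HB Require Import structures.
From mathcomp Require Import all_boot all_order all_algebra.
From mathcomp Require Import boolp.

Set Implicit Arguments.
Unset Strict Implicit.
Unset Printing Implicit Defensive.

Import GRing.Theory.

Local Open Scope ring_scope.

(* A formal power series h is its coefficient sequence: h k = [t^k] h. *)
Definition fps (R : nzRingType) : Type := nat -> R.

Definition fps_one (R : nzRingType) : fps R := fun k => (k == 0%N)%:R.

Definition fps_mul (R : nzRingType) (h1 h2 : fps R) : fps R :=
  fun k => \sum_(i < k.+1) h1 i * h2 (k - i)%N.

Definition fps_exp (R : nzRingType) (h : fps R) (m : nat) : fps R :=
  iter m (fps_mul h) (fps_one R).

Definition simple_adj n (e : {ffun 'I_n * 'I_n -> bool}) : bool :=
  [forall u, ~~ e (u, u)] && [forall u, forall v, e (u, v) == e (v, u)].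

(* Labeled simple graphs on [n], given by their adjacency; the ordinal
   u : 'I_n stands for the vertex labeled u.+1.  Equality is equality of
   labeled graphs. *)
Record sgraph (n : nat) := SGraph {
  adj :> {ffun 'I_n * 'I_n -> bool};
  _ : simple_adj adj }.

HB.instance Definition _ n := [isSub for @adj n].
HB.instance Definition _ n := [Finite of sgraph n by <:].

(* For labels i > j >= 1, whether [t^(i-2)] (g f^(j-1)) is odd. *)
Definition riordan_entry (g f : fps int) (i j : nat) : bool :=
  (fps_mul g (fps_exp f (j - 1)) (i - 2)%N == 1 %[mod 2])%Z.

Definition riordan_adj n (g f : fps int) : {ffun 'I_n * 'I_n -> bool} :=
  [ffun p : 'I_n * 'I_n =>
    let i := p.1.+1 in let j := p.2.+1 in
    if (j < i)%N then riordan_entry g f i j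
    else if (i < j)%N then riordan_entry g f j i
    else false].

Lemma riordan_adj_simple n (g f : fps int) : simple_adj (riordan_adj n g f).
Proof.
apply/andP; split; apply/forallP => u; first by rewrite ffunE /= ltnn.
by apply/forallP => v; rewrite !ffunE /=; case: ltngtP.
Qed.

Definition riordan_graph n (g f : fps int) : sgraph n :=
  SGraph (riordan_adj_simple n g f).

Definition is_riordan n (G : sgraph n) : Prop :=
  exists g f : fps int, f 0%N = 0 /\ G = riordan_graph n g f.

(* Main.v *)
Require Import Defs.
From mathcomp Require Import all_boot all_order all_algebra.
From mathcomp Require Import boolp.
From mathcomp Require Import zify.

Set Implicit Arguments.
Unset Strict Implicit.
Unset Printing Implicit Defensive.

Local Open Scope ring_scope.

Import GRing.Theory.

(** Put n = N + 1.  The neighbours of the vertices 1 and 2 record g and g f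
    modulo (2, t^N), since the powers of f involved are f^0 and f^1.

    These two columns determine the whole graph ([columns_inj]).  Recovering f
    would mean dividing by g, which need not be a unit.  Instead, given
    g = g' and g f = g' f' modulo (2, t^N), induction on m gives
    g f^(m+1) = (g' f'^m) f = (g f) f'^m = g' f'^(m+1)  ([eq_trunc_mulX]).

    A pair of columns (a, b) is realised exactly when every position where b
    is 1 is strictly preceded by one where a is 1 ([columns_image]).  This is
    forced by f(0) = 0.  Conversely, if a has its first 1 at position s, then
    a/t^s is a unit and b is a multiple of t^(s+1), so that b = a f can be
    solved for f with f(0) = 0 ([fps_div_trunc]); and if a = 0 then b = 0.

    Counting such pairs by their first entries gives c(N+1) = c(N) + 4^N:
    the pair starts with (0, 0) followed by an admissible pair, or with (1, 0)
    followed by anything.  With c(0) = 1 this is c(N) = (4^N + 2) / 3. *)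

(** * Power series *)

Lemma fps_mulr1 (R : nzRingType) (h : fps R) k : fps_mul h (fps_one R) k = h k.
Proof.
rewrite /fps_mul big_ord_recr /= subnn mulr1 big1 ?add0r // => i _.
by rewrite /fps_one subn_eq0 leqNgt ltn_ord mulr0.
Qed.

Lemma fps_mul_low0 (R : nzRingType) (g f : fps R) k :
  (forall j, (j < k)%N -> g j = 0) -> f 0%N = 0 -> fps_mul g f k = 0.
Proof.
move=> g0 f0; rewrite /fps_mul big_ord_recr /= subnn f0 mulr0 addr0.
by rewrite big1 // => i _; rewrite g0 ?mul0r.
Qed.

(** A product g f with f 0 = 0 has order greater than s, whence the condition
    on b.  Since g s = 1, the quotient already exists over the integers: f is
    found by adjusting one coefficient for each degree of g f. *)
Lemma fps_div_trunc (R : nzRingType) (g b : fps R) s N :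
    (forall j, (j < s)%N -> g j = 0) -> g s = 1 ->
    (forall j, (j <= s)%N -> b j = 0) ->
  exists2 f : fps R, f 0%N = 0 & forall k, (k < N)%N -> fps_mul g f k = b k.
Proof.
move=> g0 gs b0; elim: N => [|N [f f0 gf]]; first by exists (fun=> 0).
have [leNs | ltsN] := leqP N s.
  exists f => // k; rewrite ltnS leq_eqVlt => /predU1P[->|/gf//].
  by rewrite b0 // fps_mul_low0 // => j ltjN; rewrite g0 // (leq_trans ltjN).
(* Adding c t^(N-s) to f first affects g f at degree N, where it adds
   g s * c = c; as s < N, it leaves f 0 unchanged. *)
pose c := b N - fps_mul g f N.
exists (fun j => f j + (j == N - s)%N%:R * c).
  by rewrite f0 add0r eq_sym subn_eq0 leqNgt ltsN mul0r.
move=> k lekN; rewrite /fps_mul.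
under eq_bigr do rewrite mulrDr.
rewrite big_split /= -/(fps_mul g f k).
have [eqkN | nekN] := eqVneq k N.
  rewrite {k lekN}eqkN; have lts : (s < N.+1)%N by lia.
  rewrite (bigD1 (Ordinal lts)) //= eqxx mul1r gs mul1r big1 ?addr0.
    by rewrite /c addrC subrK.
  move=> i nei; suff -> : (N - i == N - s)%N = false by rewrite mul0r mulr0.
  apply/negbTE; move: nei; apply: contra => /eqP e; apply/eqP/val_inj => /=.
  by have := ltn_ord i; lia.
rewrite big1 ?addr0; first by apply: gf; lia.
move=> i _; have [e | _] := eqVneq (k - i)%N (N - s)%N; last by rewrite mul0r mulr0.
by rewrite g0 ?mul0r //; have := ltn_ord i; lia.
Qed.

(** * Reduction modulo two and truncation *)

Definition oddz (x : int) : bool := (x == 1 %[mod 2])%Z.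

Lemma oddz_F2 (x : int) : oddz x = (x%:~R == 1 :> 'F_2).
Proof.
rewrite /oddz eqz_mod_dvd (dvdz_pcharf (pchar_Fp (isT : prime 2))).
by rewrite rmorphB subr_eq0.
Qed.

Lemma fps_mul_map (g f : fps int) k :
  (fps_mul g f k)%:~R =
    fps_mul (fun i => (g i)%:~R : 'F_2) (fun i => (f i)%:~R) k.
Proof. by rewrite rmorph_sum; apply: eq_bigr => i _; rewrite rmorphM. Qed.

Lemma oddz_nat (b : bool) : oddz b%:R = b.
Proof. by case: b. Qed.

Lemma oddz_inj_F2 (x y : int) : oddz x = oddz y -> x%:~R = y%:~R :> 'F_2.
Proof.
rewrite !oddz_F2; move: (x%:~R) (y%:~R) => {x y}.
by move=> [[|[|[]]]//= ?] [[|[|[]]]//= ?] e; apply/val_inj.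
Qed.

Definition eq_trunc (R : nzRingType) N (p q : {poly R}) : Prop :=
  forall k, (k < N)%N -> p`_k = q`_k.

Lemma eq_truncM (R : nzRingType) N (p p' q q' : {poly R}) :
  eq_trunc N p p' -> eq_trunc N q q' -> eq_trunc N (p * q) (p' * q').
Proof.
move=> epp eqq k ltkN; rewrite !coefM; apply: eq_bigr => i _.
by have := ltn_ord i; rewrite ltnS => leik; rewrite epp ?eqq //; lia.
Qed.

(** Although p may be a zero divisor modulo t^N, so that q and q' may differ,
    each factor q can be traded for q' next to p:
    p q^(m+1) = (p' q'^m) q = (p q) q'^m = (p' q') q'^m modulo t^N. *)
Lemma eq_trunc_mulX (R : comNzRingType) N (p p' q q' : {poly R}) m :
    eq_trunc N p p' -> eq_trunc N (p * q) (p' * q') ->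
  eq_trunc N (p * q ^+ m) (p' * q' ^+ m).
Proof.
move=> ep epq; elim: m => [|m IH]; first by rewrite !expr0 !mulr1.
move=> k ltkN; transitivity ((p' * q' ^+ m) * q)`_k.
  by rewrite exprSr mulrA; apply: eq_truncM ltkN.
transitivity ((p * q) * q' ^+ m)`_k.
  rewrite -!mulrA [q' ^+ m * q]mulrC; apply: eq_truncM ltkN => // j ltjN.
  by rewrite ep.
by rewrite exprS mulrA; apply: eq_truncM ltkN.
Qed.

(** Bare coefficient sequences carry no ring structure; truncating them to
    polynomials over the field with two elements gives access to the
    commutative ring laws. *)
Definition residue N (h : fps int) : {poly 'F_2} := \poly_(k < N) (h k)%:~R.

Lemma residueM N (g f : fps int) :
  eq_trunc N (residue N (fps_mul g f)) (residue N g * residue N f).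
Proof.
move=> k ltkN; rewrite coefM coef_poly ltkN fps_mul_map; apply: eq_bigr => i _.
have := ltn_ord i; rewrite ltnS => leik.
by rewrite !coef_poly !ifT //; lia.
Qed.

Lemma residueX N (f : fps int) m :
  eq_trunc N (residue N (fps_exp f m)) (residue N f ^+ m).
Proof.
elim: m => [|m IH] k ltkN.
  by rewrite expr0 coef1 coef_poly ltkN /fps_exp /= /fps_one; case: (k == 0%N).
by rewrite residueM // exprS; apply: eq_truncM ltkN.
Qed.

Lemma residue_eq N (h h' : fps int) :
  eq_trunc N (residue N h) (residue N h') <->
  (forall k, (k < N)%N -> oddz (h k) = oddz (h' k)).
Proof.
split=> e k ltkN; have := e k ltkN; rewrite ?coef_poly ?ltkN; last exact: oddz_inj_F2.
by rewrite !oddz_F2 => ->.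
Qed.

Lemma oddz_mulX N (g f g' f' : fps int) m :
    (forall k, (k < N)%N -> oddz (g k) = oddz (g' k)) ->
    (forall k, (k < N)%N -> oddz (fps_mul g f k) = oddz (fps_mul g' f' k)) ->
  forall k, (k < N)%N ->
    oddz (fps_mul g (fps_exp f m) k) = oddz (fps_mul g' (fps_exp f' m) k).
Proof.
move=> /residue_eq eg /residue_eq egf; apply/residue_eq => k ltkN.
rewrite !residueM //.
transitivity (residue N g * residue N f ^+ m)`_k.
  by apply: eq_truncM ltkN => //; apply: residueX.
transitivity (residue N g' * residue N f' ^+ m)`_k; last first.
  by apply: eq_truncM ltkN => // j ltjN; rewrite residueX.
by apply: eq_trunc_mulX ltkN => // j ltjN; rewrite -!residueM // egf.
Qed.

(** * The first two columns of a Riordan graph *)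

Lemma riordan_adjE n (g f : fps int) (u v : 'I_n) : (v < u)%N ->
  riordan_graph n g f (u, v) = oddz (fps_mul g (fps_exp f v) u.-1).
Proof.
move=> ltvu; rewrite /= ffunE /= ltnS ltvu /riordan_entry.
by rewrite !subSS !subn0 subn1.
Qed.

Lemma riordan_column0 N (g f : fps int) k : (k < N)%N ->
  riordan_graph N.+1 g f (inord k.+1, inord 0) = oddz (g k).
Proof.
by move=> ltkN; rewrite riordan_adjE !inordK //= fps_mulr1.
Qed.

(** The case k = 0 compares a vertex with itself: the absent loop agrees with
    the constant coefficient of g f, which vanishes because f(0) = 0. *)
Lemma riordan_column1 N (g f : fps int) k : f 0%N = 0 -> (k < N)%N ->
  riordan_graph N.+1 g f (inord k.+1, inord 1) = oddz (fps_mul g f k).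
Proof.
move=> f0; case: k => [|k] ltkN.
  by rewrite /= ffunE /= ltnn fps_mul_low0.
have lt1N : (1 < N.+1)%N by lia.
rewrite riordan_adjE !inordK //=.
by congr oddz; apply: eq_bigr => i _; rewrite fps_mulr1.
Qed.

(** [inord 1] is the vertex labelled 2 only when N > 0; when N = 0 the tuple is
    empty. *)
Definition columns N (G : sgraph N.+1) : N.-tuple (bool * bool) :=
  [tuple (G (inord k.+1, inord 0), G (inord k.+1, inord 1)) | k < N].

Lemma nth_columns N (g f : fps int) k : f 0%N = 0 -> (k < N)%N ->
  nth (false, false) (columns (riordan_graph N.+1 g f)) k =
    (oddz (g k), oddz (fps_mul g f k)).
Proof.
move=> f0 ltkN; rewrite -[k]/(val (Ordinal ltkN)) -tnth_nth tnth_mktuple.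
by rewrite riordan_column0 // riordan_column1.
Qed.

Lemma columns_inj N :
  {in [pred G : sgraph N.+1 | `[< is_riordan G >]] &, injective (@columns N)}.
Proof.
move=> _ _ /asboolP[g [f [f0 ->]]] /asboolP[g' [f' [f0' ->]]] ecol.
have ecolk k : (k < N)%N ->
    oddz (g k) = oddz (g' k) /\ oddz (fps_mul g f k) = oddz (fps_mul g' f' k).
  move=> ltkN; have := congr1 (fun t => nth (false, false) (val t) k) ecol.
  by rewrite /= !nth_columns // => -[-> ->].
have eqE (u v : 'I_N.+1) : (v < u)%N ->
    riordan_graph N.+1 g f (u, v) = riordan_graph N.+1 g' f' (u, v).
  move=> ltvu; rewrite !riordan_adjE //; apply: (@oddz_mulX N).
  - by move=> k /ecolk[].
  - by move=> k /ecolk[].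
  - by have := ltn_ord u; lia.
have symE h h' (u v : 'I_N.+1) :
  riordan_graph N.+1 h h' (u, v) = riordan_graph N.+1 h h' (v, u).
  by case/andP: (riordan_adj_simple N.+1 h h') => _ /forallP/(_ u)/forallP/(_ v)/eqP.
apply/val_inj/ffunP => -[u v]; case: (ltngtP u v) => [ltuv|ltvu|/val_inj->].
- by rewrite [LHS]symE [RHS]symE; apply: eqE.
- exact: eqE.
- by rewrite /= !ffunE /= ltnn.
Qed.

(** * Counting the admissible pairs of columns *)

(** The recursive form suits the count; [admissibleP] gives the meaning: the
    second series has strictly larger order than the first, or both vanish. *)
Fixpoint admissible (s : seq (bool * bool)) : bool :=
  if s is (a, b) :: s' then ~~ b && (a || admissible s') else true.

Lemma admissibleP (s : seq (bool * bool)) :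
  reflect (forall k, (nth (false, false) s k).2 ->
             exists2 j, (j < k)%N & (nth (false, false) s j).1)
          (admissible s).
Proof.
elim: s => [|[a b] s IH] /=; first by apply: ReflectT => k; rewrite nth_nil.
apply: (iffP andP) => [[nb adm] [|k] /= | adm]; first by rewrite (negbTE nb).
- case/orP: adm => [|/IH adm /adm[j ltjk aj]]; first by exists 0%N.
  by exists j.+1.
- split; first by apply/negP => bT; have [] := adm 0%N bT.
  case: a adm => //= adm; apply/IH => k /(adm k.+1)[[|j]] //= ltjk aj.
  by exists j.
Qed.

Lemma card_admissible N :
  (3 * #|[set t : N.-tuple (bool * bool) | admissible t]| = 4 ^ N + 2)%N.
Proof.
elim: N => [|N IH].
  rewrite (_ : [set t | _] = setT) ?cardsT ?card_tuple //.
  by apply/setP => t; rewrite !inE tuple0.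
set A := [set t : N.-tuple _ | admissible t] in IH.
have consI x : injective (@cons_tuple N (bool * bool) x).
  by move=> t t' /(congr1 val)[/val_inj].
have -> : [set t : N.+1.-tuple (bool * bool) | admissible t] =
    [set cons_tuple (true, false) t | t in [set: N.-tuple (bool * bool)]]
    :|: [set cons_tuple (false, false) t | t in A].
  apply/setP => t; case/tupleP: t => -[a b] t; rewrite !inE /=.
  apply/idP/orP => [/andP[nb /orP[aT|adm]]|[]/imsetP[u uA /(congr1 val)]].
  - by left; rewrite aT (negbTE nb); apply: imset_f; rewrite inE.
  - case: a; first by left; rewrite (negbTE nb); apply: imset_f; rewrite inE.
    by right; rewrite (negbTE nb); apply: imset_f; rewrite inE.
  - by case=> -> ->.
  - by case=> -> -> /val_inj->; move: uA; rewrite inE.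
rewrite cardsU (_ : _ :&: _ = set0) ?cards0 ?subn0; last first.
  apply/setP => t; rewrite !inE; apply/negP => /andP[/imsetP[u _ ->]].
  by case/imsetP => v _ /(congr1 val)[].
rewrite !card_imset //.
by rewrite cardsT card_tuple card_prod card_bool mulnDr IH expnS addnA -mulSnr.
Qed.

(** * Realising the admissible pairs *)

(** If g vanishes modulo two below degree k, then the only other term of
    [t^k] (g f) is g_k f_0, and f_0 = 0. *)
Lemma columns_admissible N (g f : fps int) : f 0%N = 0 ->
  admissible (columns (riordan_graph N.+1 g f)).
Proof.
move=> f0; apply/admissibleP => k.
have [leNk | ltkN] := leqP N k; first by rewrite nth_default ?size_tuple.
rewrite nth_columns //=; apply: contraPP => noa.
rewrite oddz_F2 fps_mul_map fps_mul_low0 ?f0 // => j ltjk.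
apply: (@oddz_inj_F2 _ 0); apply: contra_notF noa => gj; exists j => //.
by rewrite nth_columns //= (ltn_trans ltjk).
Qed.

Lemma admissible_columns N (t : N.-tuple (bool * bool)) : admissible t ->
  exists g f : fps int, f 0%N = 0 /\ columns (riordan_graph N.+1 g f) = t.
Proof.
move=> /admissibleP adm.
pose g : fps int := fun k => (nth (false, false) t k).1%:R.
pose b : fps int := fun k => (nth (false, false) t k).2%:R.
have [f f0 gf] : exists2 f : fps int, f 0%N = 0 &
    forall k, (k < N)%N -> fps_mul g f k = b k.
  have [/existsP[k0 ak0]|/existsPn noa] :=
    boolP [exists k : 'I_N, (nth (false, false) t k).1].
    have exa : exists k, (nth (false, false) t k).1 by exists k0.
    case: (ex_minnP exa) => s as_ smin; apply: (@fps_div_trunc _ g b s N).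
    - move=> j ltjs; rewrite /g; case aj: (nth _ t j).1 => //.
      by have := smin j aj; rewrite leqNgt ltjs.
    - by rewrite /g as_.
    - move=> j lejs; rewrite /b; case bj: (nth _ t j).2 => //.
      have [i ltij ai] := adm j bj; by have := smin i ai; lia.
  exists (fun=> 0) => // k ltkN; rewrite fps_mul_low0 // => [|j ltjk].
    rewrite /b; case bk: (nth _ t k).2 => //; have [j ltjk aj] := adm k bk.
    by have /negP := noa (Ordinal (ltn_trans ltjk ltkN)).
  by have /negbTE aj := noa (Ordinal (ltn_trans ltjk ltkN)); rewrite /g aj.
exists g, f; split=> //.
apply/val_inj/(@eq_from_nth _ (false, false)); rewrite ?size_tuple // => k ltkN.
by rewrite nth_columns // gf // /g /b !oddz_nat; case: nth.
Qed.

Lemma columns_image N :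
  @columns N @: [set G : sgraph N.+1 | `[< is_riordan G >]] =
    [set t : N.-tuple (bool * bool) | admissible t].
Proof.
apply/setP => t; rewrite inE; apply/imsetP/idP => [[G]|].
  by rewrite inE => /asboolP[g [f [f0 ->]]] ->; apply: columns_admissible.
move=> /admissible_columns[g [f [f0 <-]]]; exists (riordan_graph N.+1 g f) => //.
by rewrite inE; apply/asboolP; exists g, f.
Qed.

Theorem proposition2p8 (n : nat) (n_ge1 : (1 <= n)%N) :
  #|[set G : sgraph n | `[< is_riordan G >]]|%:R = (4 ^+ (n - 1) + 2) / 3 :> rat.
Proof.
case: n n_ge1 => // N _; rewrite subn1 /=.
have -> : #|[set G : sgraph N.+1 | `[< is_riordan G >]]| =
          #|[set t : N.-tuple (bool * bool) | admissible t]|.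
  rewrite -columns_image card_in_imset // => G G'; rewrite !inE.
  exact: columns_inj.
have -> : (4 ^+ N + 2 : rat) = (4 ^ N + 2)%N%:R by rewrite natrD natrX.
by rewrite -card_admissible natrM mulrC mulKf.
Qed.
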